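(* Let $n\ge 3$ be an integer and let $g,h,f\in\mathrm{Tame}(\mathbf{k}^3)$ be defined by $g^{-1}(x_1,x_2,x_3)=(x_2,\,x_1+x_2x_3,\,x_3)$, $h^{-1}(x_1,x_2,x_3)=(x_3,x_1,x_2)$ and $f=g^n\circ h$. Then $f$ acts as a loxodromic isometry on $\mathcal{C}^1$. In particular $\mathcal{C}^1$ has infinite diameter.
   Context: Let $\mathbf{k}$ be a field of characteristic zero. Let $A_3=\mathrm{GL}_3(\mathbf{k})\ltimes\mathbf{k}^3$ be the group of affine automorphisms of $\mathbf{k}^3$ and $E_3=\{(x_1+P(x_2,x_3),x_2,x_3): P\in\mathbf{k}[x_2,x_3]\}$. The tame automorphism group is $\mathrm{Tame}(\mathbf{k}^3)=\langle A_3,E_3\rangle\subset\mathrm{Aut}(\mathbf{k}^3)$. For $r\in\{1,2,3\}$, an $r$-tuple of components is a polynomial map $(f_1,\dots,f_r)\colon\mathbf{k}^3\to\mathbf{k}^r$ which is the list of the first $r$ components of some $(f_1,f_2,f_3)\in\mathrm{Tame}(\mathbf{k}^3)$. A vertex of type $r$ is an orbit $[f_1,\dots,f_r]=\{a\circ(f_1,\dots,f_r): a\in A_r\}$, where $A_r=\mathrm{GL}_r(\mathbf{k})\ltimes\mathbf{k}^r$ acts by post-composition. The complex $\mathcal{C}$ is the 2-dimensional simplicial complex whose vertices are all vertices of types 1, 2, 3, and whose simplices are, for every $(f_1,f_2,f_3)\in\mathrm{Tame}(\mathbf{k}^3)$, the triangle spanned by $[f_1],[f_1,f_2],[f_1,f_2,f_3]$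 together with its faces. $\mathrm{Tame}(\mathbf{k}^3)$ acts on $\mathcal{C}$ by $g\cdot[f_1,\dots,f_r]=[f_1\circ g^{-1},\dots,f_r\circ g^{-1}]$. $\mathcal{C}^1$ is the 1-skeleton of $\mathcal{C}$ with the path metric where each edge has length $1$. An isometry $f$ of a metric space $X$ is loxodromic if for some (equivalently any) $x\in X$ there is $\lambda>0$ with $d(x,f^k\cdot x)\ge\lambda|k|$ for all $k\in\mathbb{Z}$. *)

(* Defs.v *)
From HB Require Import structures.
From mathcomp Require Import all_boot all_order all_algebra.
Set Implicit Arguments. Unset Strict Implicit. Unset Printing Implicit Defensive.
Import Order.TTheory GRing.Theory Num.Theory.
Local Open Scope ring_scope.

Section TameComplex.
Variable k : fieldType.

Definition pt := 'rV[k]_3.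

Definition i0 : 'I_3 := @Ordinal 3 0 isT.
Definition i1 : 'I_3 := @Ordinal 3 1 isT.
Definition i2 : 'I_3 := @Ordinal 3 2 isT.

Definition mk3 (a b c : k) : pt := \row_(i < 3) [:: a; b; c]`_i.

(* generators of Tame(k^3): affine maps x |-> x A + b (A invertible),
   and elementary maps (x1 + P(x2,x3), x2, x3), with P in k[x2][x3]
   (evaluation P.[x3%:P].[x2]). *)
Inductive gen : Type :=
| GAff of 'M[k]_3 & 'rV[k]_3
| GEl of {poly {poly k}}.

Definition gen_ok (g : gen) : Prop :=
  match g with GAff A _ => A \in unitmx | GEl _ => True end.

Definition gen_fun (g : gen) (x : pt) : pt :=
  match g with
  | GAff A b => x *m A + b
  | GEl P => mk3 (x 0 i0 + P.[(x 0 i2)%:P].[x 0 i1]) (x 0 i1) (x 0 i2)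
  end.

Definition all_ok (s : seq gen) : Prop := foldr (fun g P => gen_ok g /\ P) True s.

Definition tame (t : pt -> pt) : Prop :=
  exists s : seq gen, all_ok s /\ forall x, t x = foldr gen_fun x s.

Definition trunc (r : nat) (t : pt -> pt) : pt -> 'rV[k]_r :=
  fun x => \row_(i < r) t x 0 (inord i).

(* candidate vertices (with a representative); type 1, 2, 3 *)
Inductive vtx : Type :=
| V1 of (pt -> 'rV[k]_1)
| V2 of (pt -> 'rV[k]_2)
| V3 of (pt -> 'rV[k]_3).

Definition is_comp (r : nat) (F : pt -> 'rV[k]_r) : Prop :=
  exists t, tame t /\ forall x, F x = trunc r t x.

Definition is_vertex (v : vtx) : Prop :=
  match v with V1 F => is_comp F | V2 F => is_comp F | V3 F => is_comp F end.

Definition aff_eq (r : nat) (F G : pt -> 'rV[k]_r) : Prop :=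
  exists A : 'M[k]_r, A \in unitmx /\ exists b : 'rV[k]_r, forall x, G x = F x *m A + b.

Definition same (u v : vtx) : Prop :=
  match u, v with
  | V1 F, V1 G => aff_eq F G
  | V2 F, V2 G => aff_eq F G
  | V3 F, V3 G => aff_eq F G
  | _, _ => False
  end.

Definition pair_in (a b u w : vtx) : Prop :=
  (same u a /\ same w b) \/ (same u b /\ same w a).

(* edges of C: two distinct vertices of a triangle [f1],[f1,f2],[f1,f2,f3] *)
Definition adjacent (u w : vtx) : Prop :=
  exists t, tame t /\
    let a := V1 (trunc 1 t) in let b := V2 (trunc 2 t) in let c := V3 (trunc 3 t) in
    pair_in a b u w \/ pair_in b c u w \/ pair_in a c u w.

Fixpoint walk (m : nat) (u v : vtx) : Prop :=
  match m with
  | 0 => is_vertex u /\ same u v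
  | m'.+1 => is_vertex u /\ exists w, adjacent u w /\ walk m' w v
  end.

(* action of phi^{-1}: [F] |-> [F o phi] *)
Definition act (phi : pt -> pt) (v : vtx) : vtx :=
  match v with
  | V1 F => V1 (fun x => F (phi x))
  | V2 F => V2 (fun x => F (phi x))
  | V3 F => V3 (fun x => F (phi x))
  end.

(* action of f^z, given f and its inverse finv: f^z . [F] = [F o f^{-z}] *)
Definition actZ (f finv : pt -> pt) (z : int) (v : vtx) : vtx :=
  match z with
  | Posz m => act (iter m finv) v
  | Negz m => act (iter m.+1 f) v
  end.

Definition loxodromic (f finv : pt -> pt) : Prop :=
  exists x, is_vertex x /\
    exists lam : rat, 0 < lam /\
      forall (z : int) (m : nat), walk m x (actZ f finv z x) ->
        lam * (`|z|%:~R : rat) <= m%:R.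

Definition infinite_diameter : Prop :=
  forall N : nat, exists u v, is_vertex u /\ is_vertex v /\
    forall m, (m <= N)%N -> ~ walk m u v.

Definition ginv (x : pt) : pt := mk3 (x 0 i1) (x 0 i0 + x 0 i1 * x 0 i2) (x 0 i2).
Definition hinv (x : pt) : pt := mk3 (x 0 i2) (x 0 i0) (x 0 i1).

End TameComplex.

(* Main.v *)
Require Import Defs.
From HB Require Import structures.
From mathcomp Require Import all_boot all_order all_algebra.
From mathcomp Require Import fingroup perm mpoly zify ring.
Set Implicit Arguments. Unset Strict Implicit. Unset Printing Implicit Defensive.
Import Order.TTheory GRing.Theory Num.Theory.
Local Open Scope ring_scope.

(** Fix a monomial order on [k[x1,x2,x3]]. If [p] and [q] are affine combinations of the
components of one automorphism, then [D = jac(p, q, -)] is a locally nilpotent derivation. When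
the leading exponents [a], [b] of [p], [q] are independent, [D] acts on leading exponents [m]
with [det(a,b,m) <> 0] as the shift by [a + b - (1,1,1)], and local nilpotency forces [a] and [b]
to lie in a common coordinate plane. So along a walk in the complex the direction of the leading
exponent can only leave a side of the triangle of directions through a corner, i.e. through a
component whose leading monomial is a pure power of one variable.

Compose the walk from [x1] to [x1 o f^-M] with [f^j], for [0 <= j < M]. The direction of the
leading exponent then goes from the side [x1,x2] to the side [x2,x3], so it passes through a power
of [x2] or of [x3]. The weights (3,2,2) are chosen so that, for [n >= 3], a pure power of [x2] is
no longer pure after composing with a positive power of [f], and a pure power of [x3] is no longer
pure after composing with a positive power of [f^-1]. Hence each component on the walk serves at
most two values of [j], and the walk has length at least [M / 2]. *)

(** * A weighted order on exponents in three variables *)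

Definition wt (m : 'X_{1..3}) : nat := 3 * m i0 + 2 * m i1 + 2 * m i2.

(** Weight ties are broken by the exponents of [x1] and then [x2]; the weight then fixes that of
    [x3], so the order is total. *)
Definition wlt (a b : 'X_{1..3}) : bool :=
  (wt a < wt b)%N
  || (wt a == wt b) && ((a i0 < b i0)%N || (a i0 == b i0) && (a i1 < b i1)%N).

Lemma forall3 (P : 'I_3 -> Prop) : P i0 -> P i1 -> P i2 -> forall i, P i.
Proof.
move=> P0 P1 P2 [[|[|[|//]]] hi].
- by rewrite (_ : Ordinal hi = i0) //; apply: val_inj.
- by rewrite (_ : Ordinal hi = i1) //; apply: val_inj.
- by rewrite (_ : Ordinal hi = i2) //; apply: val_inj.
Qed.

Lemma sum3 (V : nmodType) (F : 'I_3 -> V) : \sum_(i < 3) F i = F i0 + F i1 + F i2.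
Proof.
rewrite !big_ord_recl big_ord0 addr0 addrA.
by congr (F _ + F _ + F _); apply: val_inj.
Qed.

Lemma prod3 (R : nzSemiRingType) (F : 'I_3 -> R) : \prod_(i < 3) F i = F i0 * F i1 * F i2.
Proof.
rewrite !big_ord_recl big_ord0 mulr1 mulrA.
by congr (F _ * F _ * F _); apply: val_inj.
Qed.

Lemma mnm3P (a b : 'X_{1..3}) : a i0 = b i0 -> a i1 = b i1 -> a i2 = b i2 -> a = b.
Proof. by move=> h0 h1 h2; apply/mnmP; apply: forall3. Qed.

Lemma wtD a b : wt (a + b)%MM = (wt a + wt b)%N.
Proof. by rewrite /wt !mnmDE; lia. Qed.

Lemma wtMn a d : wt (a *+ d)%MM = (wt a * d)%N.
Proof. by rewrite /wt !mulmnE; lia. Qed.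

Lemma wt_eq0 a : wt a = 0%N -> a = 0%MM.
Proof. by rewrite /wt => h; apply: mnm3P; rewrite mnm0E; lia. Qed.

Lemma wltxx a : wlt a a = false.
Proof. by rewrite /wlt; lia. Qed.

Lemma wlt_trans b a c : wlt a b -> wlt b c -> wlt a c.
Proof. by rewrite /wlt; lia. Qed.

Lemma wlt_total a b : a = b \/ wlt a b \/ wlt b a.
Proof.
rewrite /wlt; case: (eqVneq a b) => [|ne]; first by left.
right; case: (ltngtP (wt a) (wt b)) => w /=; [by left|by right|].
case: (ltngtP (a i0) (b i0)) => h0 /=; [by left|by right|].
case: (ltngtP (a i1) (b i1)) => h1 /=; [by left|by right|].
case/eqP: ne; apply: mnm3P => //; move: w; rewrite /wt; lia.
Qed.

Lemma wltD2r c a b : wlt a b -> wlt (a + c)%MM (b + c)%MM.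
Proof. by rewrite /wlt !wtD !mnmDE; lia. Qed.

Lemma wltD a b a' b' : wlt a a' -> wlt b b' -> wlt (a + b)%MM (a' + b')%MM.
Proof. by rewrite /wlt !wtD !mnmDE; lia. Qed.

Lemma wlt_wt a b : (wt a < wt b)%N -> wlt a b.
Proof. by rewrite /wlt => ->. Qed.

(** * Leading terms of polynomials *)

Section LeadingTerm.
Variable k : fieldType.
Implicit Types F G H : {mpoly k[3]}.

Definition low a F := forall b, b \in msupp F -> wlt b a.

(* [c] may be [0] here, so that [top] is additive at a fixed exponent. *)
Definition top F a c := low a (F - c *: 'X_[a]).

Lemma low0 a : low a 0.
Proof. by move=> b; rewrite msupp0. Qed.

Lemma lowD a F G : low a F -> low a G -> low a (F + G).
Proof.
by move=> hF hG b /msuppD_le; rewrite mem_cat => /orP [/hF|/hG].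
Qed.

Lemma lowZ a c F : low a F -> low a (c *: F).
Proof. by move=> hF b /msuppZ_le /hF. Qed.

Lemma lowM a b F G : low a F -> low b G -> low (a + b)%MM (F * G).
Proof.
move=> hF hG m /msuppM_le /allpairsP [[x y] /= [hx hy ->]].
by apply: wltD; [apply: hF|apply: hG].
Qed.

Lemma lowX a b F : low a F -> low (a + b)%MM ('X_[b] * F).
Proof.
move=> hF m /msuppM_le /allpairsP [[x y] /= [+ hy ->]].
rewrite msuppX inE => /eqP ->; rewrite addmC.
exact/wltD2r/hF.
Qed.

Lemma low_trans a b F : wlt a b -> low a F -> low b F.
Proof. by move=> hab hF m /hF /wlt_trans; apply. Qed.

Lemma topD F G a c d : top F a c -> top G a d -> top (F + G) a (c + d).
Proof.
move=> hF hG; rewrite /top scalerDl (_ : _ - _ = (F - c *: 'X_[a]) + (G - d *: 'X_[a])).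
  exact: lowD.
by rewrite opprD addrACA.
Qed.

Lemma topZ e F a c : top F a c -> top (e *: F) a (e * c).
Proof. by move=> hF; rewrite /top -scalerA -scalerBr; apply: lowZ. Qed.

Lemma topN F a c : top F a c -> top (- F) a (- c).
Proof. by move=> hF; rewrite -(scaleN1r F) -(mulN1r c); apply: topZ. Qed.

Lemma topB F G a c d : top F a c -> top G a d -> top (F - G) a (c - d).
Proof. by move=> hF /topN; apply: topD. Qed.

Lemma topX a : top 'X_[a] a 1.
Proof. by rewrite /top scale1r subrr; apply: low0. Qed.

Lemma topC c : top c%:MP 0%MM c.
Proof. by rewrite /top mpolyX0 alg_mpolyC subrr; apply: low0. Qed.

Lemma low_top F a : low a F -> top F a 0.
Proof. by rewrite /top scale0r subr0. Qed.

Lemma top_low F a c b : top F a c -> wlt a b -> low b F.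
Proof.
move=> hF hab; rewrite -[F](subrK (c *: 'X_[a])).
apply: lowD; first exact: low_trans hab hF.
by apply: lowZ => m; rewrite msuppX inE => /eqP ->.
Qed.

Lemma topM F G a b c d : top F a c -> top G b d -> top (F * G) (a + b)%MM (c * d).
Proof.
move=> hF hG; rewrite /top.
have -> : F * G - (c * d) *: 'X_[a + b] =
   (F - c *: 'X_[a]) * (G - d *: 'X_[b]) + (d *: ('X_[b] * (F - c *: 'X_[a]))
   + c *: ('X_[a] * (G - d *: 'X_[b]))).
  rewrite mpolyXD -!mul_mpolyC mpolyCM; ring.
apply: lowD; first exact: lowM.
apply: lowD; apply: lowZ; first exact: lowX.
by rewrite addmC; apply: lowX.
Qed.

Lemma topXn F a c d : top F a c -> top (F ^+ d) (a *+ d)%MM (c ^+ d).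
Proof.
move=> hF; elim: d => [|d IH].
  by rewrite !expr0 -mpolyC1 mulm0n; apply: topC.
by rewrite !exprS mulmS; apply: topM.
Qed.

Lemma top_coeff F a c : top F a c -> F@_a = c.
Proof.
move=> hF; apply/eqP; rewrite -subr_eq0; apply: contraT => ne.
have : a \in msupp (F - c *: 'X_[a]).
  by rewrite mcoeff_msupp mcoeffB mcoeffZ mcoeffX eqxx mulr1.
by move/hF; rewrite wltxx.
Qed.

Lemma top_inj F a b c d : top F a c -> top F b d -> c != 0 -> d != 0 -> a = b.
Proof.
move=> hF hG c0 d0; case: (wlt_total a b) => [//|[lab|lba]].
- have := top_low hF lab; move/(_ b); rewrite mcoeff_msupp (top_coeff hG) d0 wltxx.
  by move/(_ isT).
- have := top_low hG lba; move/(_ a); rewrite mcoeff_msupp (top_coeff hF) c0 wltxx.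
  by move/(_ isT).
Qed.

Lemma top_neq0 F a c : top F a c -> c != 0 -> F != 0.
Proof.
by move=> /top_coeff hF; apply: contra_neqT => /negPn /eqP F0; rewrite -hF F0 mcoeff0.
Qed.

Lemma top_exists F : F != 0 -> exists a c, c != 0 /\ top F a c.
Proof.
move=> F0.
have max (s : seq 'X_{1..3}) : s != [::] ->
    exists2 a, a \in s & forall b, b \in s -> b != a -> wlt b a.
  elim: s => [//|x s IH] _; case: (altP (s =P [::])) => [-> | /IH [a sa ha]].
    by exists x; rewrite ?inE // => b; rewrite inE => ->.
  case: (wlt_total x a) => [xa|[xa|ax]].
  - exists a => [|b]; rewrite inE ?sa ?orbT // xa => /orP [-> //|]; exact: ha.
  - exists a => [|b]; rewrite inE ?sa ?orbT // => /orP [/eqP -> //|]; exact: ha.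
  - exists x => [|b]; rewrite inE ?eqxx // => /orP [-> //|sb _].
    case: (eqVneq b a) => [-> //|ba]; exact: wlt_trans (ha _ sb ba) ax.
have [|a sa ha] := max (msupp F); first by rewrite msupp_eq0.
exists a, F@_a; rewrite -mcoeff_msupp; split => // b hb.
have ba : b != a.
  apply/eqP => ba; move: hb; rewrite ba mcoeff_msupp mcoeffB mcoeffZ mcoeffX eqxx.
  by rewrite mulr1 subrr eqxx.
apply: (ha) => //; move: hb; rewrite !mcoeff_msupp mcoeffB mcoeffZ mcoeffX.
by rewrite [a == b]eq_sym (negbTE ba) mulr0 subr0.
Qed.

(** Unlike the bare partial derivative, this operator preserves exponents: it multiplies the
    monomial of exponent [a] by [a i]. *)
Definition euler i F : {mpoly k[3]} := 'X_i * F^`M(i).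

Lemma euler_low i a F : low a F -> low a (euler i F).
Proof.
move=> hF m /msuppM_le /allpairsP [[x y] /= [+ hy ->]].
rewrite msuppX inE => /eqP ->; apply: hF; rewrite mcoeff_msupp.
move: hy; rewrite mcoeff_msupp mcoeff_deriv; apply: contra_neqN => /eqP.
by rewrite addmC => ->; rewrite mul0rn.
Qed.

Lemma euler_top i a F c : top F a c -> top (euler i F) a ((a i)%:R * c).
Proof.
move=> hF; rewrite /top.
have -> : euler i F - ((a i)%:R * c) *: 'X_[a] = euler i (F - c *: 'X_[a]).
  rewrite /euler mderivB mderivZ mderivX mulrBr; congr (_ - _).
  (* When [a i] is 0, subtracting [U_(i)] from [a] truncates, but the coefficient is 0 then. *)
  rewrite -!scalerAr scalerA [c * _]mulrC; case: (posnP (a i)) => [->|ai].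
    by rewrite mul0r !scale0r.
  congr (_ *: _); rewrite -mpolyXD addmC submK //.
  by apply/mnm_lepP => j; rewrite mnm1E; case: eqP => // <-.
exact: euler_low.
Qed.

End LeadingTerm.

(** * Jacobian derivations and local nilpotency *)

Section Jacobian.
Variable k : fieldType.
Implicit Types F G H : {mpoly k[3]}.

Definition jac F G H : {mpoly k[3]} :=
  F^`M(i0) * (G^`M(i1) * H^`M(i2) - G^`M(i2) * H^`M(i1))
  - F^`M(i1) * (G^`M(i0) * H^`M(i2) - G^`M(i2) * H^`M(i0))
  + F^`M(i2) * (G^`M(i0) * H^`M(i1) - G^`M(i1) * H^`M(i0)).

Lemma jacD F G H H' : jac F G (H + H') = jac F G H + jac F G H'.
Proof. rewrite /jac !mderivD; ring. Qed.

Lemma jacM F G H H' : jac F G (H * H') = jac F G H * H' + H * jac F G H'.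
Proof. rewrite /jac !mderivM; ring. Qed.

Lemma jacC F G c : jac F G c%:MP = 0.
Proof. rewrite /jac !mderivC; ring. Qed.

Lemma jac_rot F G H : jac F G H = jac G H F.
Proof. rewrite /jac; ring. Qed.

Lemma jacFF F G : jac F G F = 0.
Proof. rewrite /jac; ring. Qed.

Lemma jacGG F G : jac F G G = 0.
Proof. rewrite /jac; ring. Qed.

(** The determinant of three exponents, read in the field because it occurs as the coefficient of a
    leading term. *)
Definition det3 (a b c : 'X_{1..3}) : k :=
  (a i0)%:R * ((b i1)%:R * (c i2)%:R - (b i2)%:R * (c i1)%:R)
  - (a i1)%:R * ((b i0)%:R * (c i2)%:R - (b i2)%:R * (c i0)%:R)
  + (a i2)%:R * ((b i0)%:R * (c i1)%:R - (b i1)%:R * (c i0)%:R).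

(** Multiplication by [x1 x2 x3] turns partial derivatives into Euler operators, which act on
    leading terms by scalars. The resulting coefficient may be 0. *)
Lemma top_jac F G H a b m c d e : top F a c -> top G b d -> top H m e ->
  top ('X_i0 * 'X_i1 * 'X_i2 * jac F G H) (a + (b + m))%MM (det3 a b m * (c * d * e)).
Proof.
move=> hF hG hH.
have -> : 'X_i0 * 'X_i1 * 'X_i2 * jac F G H =
  euler i0 F * (euler i1 G * euler i2 H - euler i2 G * euler i1 H)
  - euler i1 F * (euler i0 G * euler i2 H - euler i2 G * euler i0 H)
  + euler i2 F * (euler i0 G * euler i1 H - euler i1 G * euler i0 H).
  rewrite /euler /jac; ring.
have T i j : top (euler i G * euler j H) (b + m)%MM ((b i)%:R * d * ((m j)%:R * e)).
  by apply: topM; apply: euler_top.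
have := topD (topB (topM (euler_top (i := i0) hF) (topB (T i1 i2) (T i2 i1)))
  (topM (euler_top (i := i1) hF) (topB (T i0 i2) (T i2 i0))))
  (topM (euler_top (i := i2) hF) (topB (T i0 i1) (T i1 i0))).
congr top; rewrite /det3; ring.
Qed.

(** A nonzero determinant makes the coefficient in [top_jac] nonzero; cancelling [x1 x2 x3]
    subtracts (1,1,1) from the exponent, written with sums to avoid truncated subtraction. *)
Lemma top_jac_step F G H a b m c d e : top F a c -> top G b d -> top H m e ->
  c != 0 -> d != 0 -> e != 0 -> det3 a b m != 0 ->
  exists m' e', [/\ e' != 0, top (jac F G H) m' e' &
    forall j, (m' j + 1 = a j + b j + m j)%N].
Proof.
move=> hF hG hH c0 d0 e0 det0; have hJ := top_jac hF hG hH.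
have nz : det3 a b m * (c * d * e) != 0 by rewrite !mulf_neq0.
have J0 : jac F G H != 0.
  by apply: contraTneq (top_neq0 hJ nz) => ->; rewrite mulr0 eqxx.
have [m' [e' [e'0 hm']]] := top_exists J0; exists m', e'; split=> // j.
have hJ' : top ('X_i0 * 'X_i1 * 'X_i2 * jac F G H) (U_(i0) + U_(i1) + U_(i2) + m')%MM
    (1 * 1 * 1 * e').
  by do ![apply: topM] => //; apply: topX.
have := top_inj hJ hJ' nz; rewrite !mul1r => /(_ e'0) /mnmP /(_ j).
rewrite !mnmDE !mnm1E => h.
have : ((i0 == j) + (i1 == j) + (i2 == j) = 1)%N by move: j {h}; apply: forall3.
by move: h; lia.
Qed.

(** Either the cross product of the exponents is 0, so that nonzero ones have the same direction, or
    both lie in one coordinate plane. *)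
Definition coplanar (a b : 'X_{1..3}) : Prop :=
  [/\ a i1 * b i2 = a i2 * b i1, a i0 * b i2 = a i2 * b i0 &
    a i0 * b i1 = a i1 * b i0]%N \/ exists i, a i = 0%N /\ b i = 0%N.

Hypothesis hk : [pchar k] =i pred0.

Lemma natk_eq0 m : (m%:R == 0 :> k) = (m == 0%N).
Proof. exact: (pcharf0P k).1. Qed.

Lemma natk_inj (m p : nat) : m%:R = p%:R :> k -> m = p.
Proof.
wlog mp : m p / (m <= p)%N.
  by move=> h; case: (leqP m p) => [|/ltnW] l e; [|symmetry]; apply: h.
move=> e; have : (p - m)%:R == 0 :> k by rewrite natrB // e subrr.
by rewrite natk_eq0; lia.
Qed.

(* If [det3 a b m <> 0] then [D = jac F G] shifts the leading exponent [m] by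
   [a + b - (1,1,1)]. Starting from ['X_i], nilpotency forces the determinant to vanish
   after finitely many shifts. *)
Lemma det3_unit F G a b c d i : top F a c -> top G b d -> c != 0 -> d != 0 ->
  (exists N, iter N (jac F G) 'X_i = 0) ->
  exists m : nat, det3 a b U_(i) =
    m%:R * (det3 a b U_(i0) + det3 a b U_(i1) + det3 a b U_(i2)).
Proof.
move=> hF hG c0 d0 [N0 hN0].
have step N : (exists m : nat, det3 a b U_(i) =
    m%:R * (det3 a b U_(i0) + det3 a b U_(i1) + det3 a b U_(i2))) \/
  exists m e, [/\ e != 0, top (iter N (jac F G) 'X_i) m e &
    forall j, (m j + N = U_(i)%MM j + N * (a j + b j))%N].
  elim: N => [|N [IH|[m [e [e0 hm hmj]]]]]; [|by left|].
    right; exists U_(i)%MM, 1; split; rewrite ?oner_neq0 //.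
    exact: topX.
  case: (eqVneq (det3 a b m) 0) => [m0|m0].
    (* Here [m = U_(i) + N (a + b - (1,1,1))]. The determinant is linear in its last argument and
       vanishes at [a] and [b], so the multiplier is [N]. *)
    left; exists N.
    have E j : (m j)%:R = (U_(i)%MM j)%:R + N%:R * ((a j)%:R + (b j)%:R) - N%:R :> k.
      by rewrite -natrD -natrM -natrD -hmj natrD addrK.
    move: m0; rewrite /det3 !E !mnm1E /= => m0; apply/eqP; rewrite -subr_eq0 -{}m0.
    apply/eqP; ring.
  have [m' [e' [e'0 hm' hm'j]]] := top_jac_step hF hG hm c0 d0 e0 m0.
  right; exists m', e'; split=> // j.
  by move: (hmj j) (hm'j j) => /=; lia.
case: (step N0) => [//|[m [e [e0 hm _]]]].
by move: (top_neq0 hm e0); rewrite hN0 eqxx.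
Qed.

(** The cross product has entries [m0 s], [m1 s], [m2 s] with sum [s]. If [s] is 0 it vanishes;
    otherwise the naturals [m0], [m1], [m2] sum to 1, so it is supported on one coordinate, and
    orthogonality makes [a] and [b] vanish there. *)
Lemma locally_nilpotent_coplanar F G a b c d : top F a c -> top G b d ->
  c != 0 -> d != 0 -> (forall i, exists N, iter N (jac F G) 'X_i = 0) -> coplanar a b.
Proof.
move=> hF hG c0 d0 nil.
have D i := det3_unit hF hG c0 d0 (nil i).
have [m0 h0] := D i0; have [m1 h1] := D i1; have [m2 h2] := D i2.
set s := (det3 a b U_(i0) + det3 a b U_(i1) + det3 a b U_(i2)) in h0 h1 h2.
have s1 : s = (m0 + m1 + m2)%:R * s by rewrite !natrD !mulrDl -h0 -h1 -h2.
have E0 : (a i1)%:R * (b i2)%:R - (a i2)%:R * (b i1)%:R = m0%:R * s.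
  by rewrite -h0 /det3 !mnm1E /=; ring.
have E1 : (a i2)%:R * (b i0)%:R - (a i0)%:R * (b i2)%:R = m1%:R * s.
  by rewrite -h1 /det3 !mnm1E /=; ring.
have E2 : (a i0)%:R * (b i1)%:R - (a i1)%:R * (b i0)%:R = m2%:R * s.
  by rewrite -h2 /det3 !mnm1E /=; ring.
case: (eqVneq s 0) => [s0|s0].
  left; move/eqP: E0; move/eqP: E1; move/eqP: E2; rewrite s0 !mulr0 !subr_eq0 -!natrM.
  by move=> /eqP /natk_inj e2 /eqP /natk_inj e1 /eqP /natk_inj e0.
right.
have M : (m0 + m1 + m2 = 1)%N.
  by apply: natk_inj; apply: (mulIf s0); rewrite mul1r -s1.
have orth (x : 'X_{1..3}) : (x i0)%:R * ((a i1)%:R * (b i2)%:R - (a i2)%:R * (b i1)%:R)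
   + (x i1)%:R * ((a i2)%:R * (b i0)%:R - (a i0)%:R * (b i2)%:R)
   + (x i2)%:R * ((a i0)%:R * (b i1)%:R - (a i1)%:R * (b i0)%:R) = 0 :> k ->
   (x i0 * m0 + x i1 * m1 + x i2 * m2 = 0)%N.
  rewrite E0 E1 E2 !mulrA -!mulrDl -!natrM -!natrD => /eqP.
  by rewrite mulf_eq0 (negbTE s0) orbF natk_eq0 => /eqP.
have {orth} [oa ob] : (a i0 * m0 + a i1 * m1 + a i2 * m2 = 0 /\
    b i0 * m0 + b i1 * m1 + b i2 * m2 = 0)%N.
  by split; apply: orth; ring.
have : (m0 = 1 \/ m1 = 1 \/ m2 = 1)%N by lia.
case=> [m|[m|m]]; [exists i0|exists i1|exists i2]; move: oa ob; rewrite m; lia.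
Qed.

End Jacobian.

(** * Polynomial components of tame automorphisms *)

Section TamePolynomials.
Variable k : fieldType.
Implicit Types (F G H : {mpoly k[3]}) (P : 'I_3 -> {mpoly k[3]}) (p q : pt k -> k).

(** Subalgebras as predicates: a property closed in this way need only be checked on a generating
    family. *)
Definition subalg (S : {mpoly k[3]} -> Prop) : Prop :=
  [/\ forall c, S c%:MP, forall F G, S F -> S G -> S (F + G) &
    forall F G, S F -> S G -> S (F * G)].

Lemma subalg_sum S (I : Type) (r : seq I) (E : I -> {mpoly k[3]}) :
  subalg S -> (forall i, S (E i)) -> S (\sum_(i <- r) E i).
Proof.
case=> SC SD _ SE; apply: (big_ind S) => //.
by rewrite -mpolyC0; apply: SC.
Qed.

Lemma subalg_exp S F d : subalg S -> S F -> S (F ^+ d).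
Proof.
case=> SC _ SM SF; elim: d => [|d IH]; first by rewrite expr0 -mpolyC1; apply: SC.
by rewrite exprS; apply: SM.
Qed.

Lemma subalg_opp S F : subalg S -> S F -> S (- F).
Proof.
case=> SC _ SM SF; rewrite -mulN1r -mpolyC1 -mpolyCN; exact: SM.
Qed.

Lemma subalg_jac_kernel F G : subalg (fun H => jac F G H = 0).
Proof.
split=> [c|H H' h h'|H H' h h']; first exact: jacC.
- by rewrite jacD h h' addr0.
- by rewrite jacM h h' mul0r mulr0 addr0.
Qed.

Lemma iter_jac0 F G N : iter N (jac F G) 0 = 0.
Proof. by elim: N => //= N ->; rewrite -mpolyC0 jacC. Qed.

Lemma iter_jacD F G N H H' :
  iter N (jac F G) (H + H') = iter N (jac F G) H + iter N (jac F G) H'.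
Proof. by elim: N => //= N ->; rewrite jacD. Qed.

(** By Leibniz's rule the derivative of the product has two terms, each lowering one of the two
    orders, hence the double induction. *)
Lemma iter_jacM F G N M H H' : iter N (jac F G) H = 0 -> iter M (jac F G) H' = 0 ->
  iter (N + M) (jac F G) (H * H') = 0.
Proof.
elim: N M H H' => [|N IHN] M H H'; first by move=> /= -> _; rewrite mul0r iter_jac0.
elim: M H H' => [|M IHM] H H' hH hH'; first by rewrite [H']hH' mulr0 iter_jac0.
rewrite addSn iterSr jacM iter_jacD.
rewrite IHN -?iterSr // add0r -addSnnS.
by apply: IHM; rewrite -?iterSr.
Qed.

Lemma subalg_nilpotent F G : subalg (fun H => exists N, iter N (jac F G) H = 0).
Proof.
split=> [c|H H' [N h] [N' h']|H H' [N h] [N' h']]; first by exists 1%N; rewrite /= jacC.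
- exists (N + N')%N; rewrite iter_jacD {1}addnC !iterD h h' !iter_jac0 addr0 //.
- by exists (N + N')%N; apply: iter_jacM.
Qed.

(** The inner variable of [Q] becomes [F] and the outer one [G], as in the evaluation that defines
    elementary maps. *)
Definition poly2_at (Q : {poly {poly k}}) F G : {mpoly k[3]} :=
  \sum_(i < size Q) \sum_(j < size Q`_i) (Q`_i`_j)%:MP * (F ^+ j * G ^+ i).

Lemma meval_poly2_at Q F G v :
  (poly2_at Q F G).@[v] = Q.[(G.@[v])%:P].[F.@[v]].
Proof.
rewrite (horner_coef Q) horner_sum raddf_sum; apply: eq_bigr => i _.
rewrite hornerM -polyC_exp hornerC horner_coef mulr_suml raddf_sum.
apply: eq_bigr => j _.
by rewrite /= !mevalM !rmorphXn /= mevalC mulrA.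
Qed.

Lemma subalg_poly2_at S Q F G : subalg S -> S F -> S G -> S (poly2_at Q F G).
Proof.
move=> hS SF SG; have [SC _ SM] := hS.
apply: subalg_sum => // i; apply: subalg_sum => // j.
by apply: (SM) => //; apply: SM; apply: subalg_exp.
Qed.

Definition represents (t : pt k -> pt k) P : Prop :=
  forall x i, t x 0 i = (P i).@[x 0].

(** Two traces of invertibility: a constant Jacobian, and components that generate the polynomial
    ring, phrased as membership of the variables in every subalgebra containing the components. *)
Definition tame_polys P : Prop :=
  (exists c, jac (P i0) (P i1) (P i2) = c%:MP) /\
  forall S, subalg S -> (forall i, S (P i)) -> forall i, S 'X_i.

Definition aff_comb (u : 'cV[k]_3) b P : {mpoly k[3]} :=
  \sum_(j < 3) (u j 0)%:MP * P j + b%:MP.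

Lemma meval_aff_comb u b P v :
  (aff_comb u b P).@[v] = \sum_(j < 3) (P j).@[v] * u j 0 + b.
Proof.
rewrite mevalD mevalC raddf_sum; congr (_ + _); apply: eq_bigr => j _.
by rewrite /= mevalM mevalC mulrC.
Qed.

Lemma mderiv_aff_comb u b P i :
  (aff_comb u b P)^`M(i) =
    (u i0 0)%:MP * (P i0)^`M(i) + (u i1 0)%:MP * (P i1)^`M(i) + (u i2 0)%:MP * (P i2)^`M(i).
Proof. by rewrite /aff_comb sum3 !mderivD !mderiv_mulC mderivC addr0. Qed.

Lemma jac_aff_comb (u v w : 'cV[k]_3) bu bv bw P : exists c,
  jac (aff_comb u bu P) (aff_comb v bv P) (aff_comb w bw P) =
    c%:MP * jac (P i0) (P i1) (P i2).
Proof.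
(* The determinant of the matrix with columns [u], [v], [w]. *)
exists (u i0 0 * (v i1 0 * w i2 0 - v i2 0 * w i1 0)
  - u i1 0 * (v i0 0 * w i2 0 - v i2 0 * w i0 0)
  + u i2 0 * (v i0 0 * w i1 0 - v i1 0 * w i0 0)).
rewrite !(mpolyCD, mpolyCB, mpolyCM) /jac !mderiv_aff_comb; ring.
Qed.

Lemma aff_comb_delta P i : aff_comb (delta_mx i 0) 0 P = P i.
Proof.
rewrite /aff_comb (bigD1 i) //= mxE !eqxx mpolyC1 mul1r mpolyC0 addr0 big1 ?addr0 //.
by move=> j /negbTE ji; rewrite mxE ji mpolyC0 mul0r.
Qed.

Lemma tame_polys_id : tame_polys (fun i => 'X_i).
Proof.
split=> [|S _ //]; exists 1.
have D (i j : 'I_3) : ('X_i : {mpoly k[3]})^`M(j) = (i == j)%:R%:MP.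
  rewrite mderivX mnm1E; case: eqP => [->|_]; last by rewrite scale0r mpolyC0.
  by rewrite -{1}[U_(j)%MM]add0m addmK mpolyX0 scale1r mpolyC1.
rewrite /jac !D /= mpolyC0 mpolyC1; ring.
Qed.

Lemma tame_polys_aff P (A : 'M[k]_3) (b : 'rV[k]_3) : A \in unitmx ->
  tame_polys P -> tame_polys (fun i => aff_comb (col i A) (b 0 i) P).
Proof.
move=> uA [[c hc] gen]; split.
  have [d ->] := jac_aff_comb (col i0 A) (col i1 A) (col i2 A) (b 0 i0) (b 0 i1) (b 0 i2) P.
  by exists (d * c); rewrite hc mpolyCM.
move=> S hS SP; apply: gen => // j; have [SC SD SM] := hS.
(* The inverse matrix recovers each old component from the new ones. *)
have -> : P j = \sum_(i < 3) (invmx A i j)%:MP *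
    (aff_comb (col i A) (b 0 i) P + - (b 0 i)%:MP).
  transitivity (\sum_(l < 3) ((A *m invmx A) l j)%:MP * P l).
    rewrite mulmxV // (bigD1 j) //= mxE eqxx mpolyC1 mul1r big1 ?addr0 //.
    by move=> l /negbTE lj; rewrite mxE lj mpolyC0 mul0r.
  under [RHS]eq_bigr => i _ do rewrite addrK mulr_sumr.
  rewrite exchange_big; apply: eq_bigr => l _; rewrite mxE raddf_sum mulr_suml.
  by apply: eq_bigr => i _; rewrite /= mpolyCM mxE; ring.
apply: subalg_sum => // i; apply: SM => //; apply: SD => //.
exact: subalg_opp.
Qed.

Definition elem_polys Q P (i : 'I_3) : {mpoly k[3]} :=
  if i == i0 then P i0 + poly2_at Q (P i1) (P i2) else P i.

(** The added term is a polynomial in [P i1] and [P i2], so the derivation [jac (P i1) (P i2)] kills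
    it and the Jacobian does not change. *)
Lemma tame_polys_elem P Q : tame_polys P -> tame_polys (elem_polys Q P).
Proof.
move=> [[c hc] gen]; split.
  exists c; rewrite -hc /elem_polys /= jac_rot jacD (_ : jac _ _ (poly2_at _ _ _) = 0).
    by rewrite addr0 -jac_rot.
  apply: (subalg_poly2_at (S := fun H => jac (P i1) (P i2) H = 0));
    [exact: subalg_jac_kernel|exact: jacFF|exact: jacGG].
move=> S hS SP; have [SC SD SM] := hS; apply: gen => //.
have S1 : S (P i1) := SP i1.
have S2 : S (P i2) := SP i2.
apply: forall3 => //.
have -> : P i0 = elem_polys Q P i0 + - poly2_at Q (P i1) (P i2) by rewrite /elem_polys addrK.
by apply: SD => //; apply: subalg_opp => //; apply: subalg_poly2_at.
Qed.

Lemma mk3E (a b c : k) i :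
  mk3 a b c 0 i = if i == i0 then a else if i == i1 then b else c.
Proof. by rewrite mxE; move: i; apply: forall3. Qed.

Lemma tame_represents (t : pt k -> pt k) : tame t ->
  exists P, represents t P /\ tame_polys P.
Proof.
case=> s [ok ht]; suff [P [hP tP]] : exists P,
    represents (fun x => foldr (@gen_fun k) x s) P /\ tame_polys P.
  by exists P; split=> // x i; rewrite ht hP.
elim: s ok {t ht} => [_|g s IH /= [okg /IH [P [hP tP]]]].
  exists (fun i => 'X_i); split; last exact: tame_polys_id.
  by move=> x i; rewrite mevalXU.
case: g okg => [A b uA|Q _] /=.
  exists (fun i => aff_comb (col i A) (b 0 i) P); split; last exact: tame_polys_aff.
  move=> x i; rewrite /= !mxE meval_aff_comb; congr (_ + _).
  by apply: eq_bigr => j _; rewrite hP mxE.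
exists (elem_polys Q P); split; last exact: tame_polys_elem.
move=> x i; rewrite /= mk3E /elem_polys; move: i; apply: forall3 => //=.
by rewrite !hP mevalD meval_poly2_at.
Qed.

Lemma tame_surj (t : pt k -> pt k) : tame t -> forall y, exists x, t x = y.
Proof.
case=> s [ok ht] y; suff [x hx] : exists x, foldr (@gen_fun k) x s = y.
  by exists x; rewrite ht.
elim: s ok y {t ht} => [_ y|g s IH /= [okg /IH {}IH] y]; first by exists y.
suff [z <-] : exists z, gen_fun g z = y by have [x <-] := IH z; exists x.
case: g okg => [A b uA|Q _] /=.
  by exists ((y - b) *m invmx A); rewrite mulmxKV // subrK.
exists (mk3 (y 0 i0 - Q.[(y 0 i2)%:P].[y 0 i1]) (y 0 i1) (y 0 i2)).
apply/rowP; apply: forall3; by rewrite !mk3E /= ?subrK.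
Qed.

(** The derivation sends each component [P i] to a constant, so its square kills the components; as
    these generate, it is nilpotent on every variable. *)
Lemma aff_comb_coplanar P u v bu bv a b c d : [pchar k] =i pred0 -> tame_polys P ->
  top (aff_comb u bu P) a c -> top (aff_comb v bv P) b d -> c != 0 -> d != 0 ->
  coplanar a b.
Proof.
move=> hk [[e he] gen] hF hG c0 d0.
apply: (locally_nilpotent_coplanar hk hF hG c0 d0).
apply: (gen _ (subalg_nilpotent _ _)).
move=> i; exists 2%N.
have [f hf] := jac_aff_comb u v (delta_mx i 0) bu bv 0 P.
by rewrite /= -(aff_comb_delta P i) hf he -mpolyCM jacC.
Qed.

End TamePolynomials.

(** * Leading exponents of polynomial functions *)

Section LeadingExponent.
Variable k : fieldType.
Hypothesis hk : [pchar k] =i pred0.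
Implicit Types (F G H : {mpoly k[3]}) (P : 'I_3 -> {mpoly k[3]}) (p q r : pt k -> k).

(* Kronecker substitution (x1,x2,x3) = (s^(B^2), s^B, s), with [B] above the degree of [F] *)
Lemma mpoly_fun_eq0 F : (forall x : pt k, F.@[x 0] = 0) -> F = 0.
Proof.
move=> hF; apply/eqP; apply: contraT => F0.
have [m0 hm0] : exists m, m \in msupp F.
  by move: F0; rewrite -msupp_eq0; case: (msupp F) => // m s _; exists m; rewrite mem_head.
pose B := msize F; pose e (m : 'X_{1..3}) := (m i0 * B ^ 2 + m i1 * B + m i2)%N.
have ltB m i : m \in msupp F -> (m i < B)%N.
  move/msize_mdeg_lt; apply: leq_ltn_trans; rewrite mdegE sum3.
  by move: i; apply: forall3 => /=; lia.
have e_inj m m' : m \in msupp F -> m' \in msupp F -> e m = e m' -> m = m'.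
  move=> hm hm'; rewrite /e.
  move: (ltB _ i0 hm) (ltB _ i1 hm) (ltB _ i2 hm) (ltB _ i0 hm') (ltB _ i1 hm') (ltB _ i2 hm').
  move=> b0 b1 b2 c0 c1 c2 E.
  have E2 : m i2 = m' i2.
    have := congr1 (fun j => j %% B)%N E => /=.
    by rewrite -[(B ^ 2)%N]mulnn !mulnA -!mulnDl !modnMDl !modn_small.
  have E01 : (m i0 * B + m i1 = m' i0 * B + m' i1)%N.
    have B0 : (0 < B)%N by lia.
    apply/eqP; rewrite -(eqn_pmul2r B0); apply/eqP; move: E E2; rewrite -mulnn; lia.
  have E1 : m i1 = m' i1 by have := congr1 (fun j => j %% B)%N E01; rewrite /= !modnMDl !modn_small.
  have E0 : m i0 = m' i0.
    by have := congr1 (fun j => j %/ B)%N E01; rewrite /= !divnMDl ?divn_small ?addn0 //; lia.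
  exact: mnm3P.
pose Q : {poly k} := \sum_(m <- msupp F) F@_m *: 'X^(e m).
have Qs s : Q.[s] = 0.
  rewrite -(hF (mk3 (s ^+ (B ^ 2)) (s ^+ B) s)) mevalE horner_sum; apply: eq_bigr => m _.
  rewrite hornerZ hornerXn prod3 !mk3E /= /e; congr (_ * _).
  by rewrite -!exprM -!exprD ![(_ ^ _ * m _)%N]mulnC ![(B * m _)%N]mulnC.
have Q0 : Q = 0.
  apply: (@roots_geq_poly_eq0 _ Q [seq j%:R | j <- iota 0 (size Q)]).
  - by apply/allP => s _; rewrite /root Qs.
  - by rewrite map_inj_uniq ?iota_uniq // => i j; apply: natk_inj.
  - by rewrite size_map size_iota.
have : Q`_(e m0) = F@_m0.
  rewrite coef_sum (bigD1_seq m0) //= coefZ coefXn eqxx mulr1 big1_seq ?addr0 //.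
  move=> m /andP [ne hm]; rewrite coefZ coefXn; case: eqP => [/e_inj E|]; last by rewrite mulr0.
  by rewrite E ?eqxx // in ne.
by rewrite Q0 coef0 => /esym /eqP; rewrite mcoeff_eq0 hm0.
Qed.

Lemma mpoly_fun_inj F G : (forall x : pt k, F.@[x 0] = G.@[x 0]) -> F = G.
Proof.
move=> h; apply/eqP; rewrite -subr_eq0; apply/eqP; apply: mpoly_fun_eq0 => x.
by rewrite mevalB h subrr.
Qed.

(** Leading exponents are attached to functions because vertices are represented by functions;
    [lexp_inj] shows that the exponent is unique. *)
Definition lexp p a : Prop :=
  exists F c, [/\ forall x, p x = F.@[x 0], c != 0 & top F a c].

Lemma lexp_inj p a b : lexp p a -> lexp p b -> a = b.
Proof.
case=> F [c [pF c0 hF]] [G [d [pG d0 hG]]].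
have E : F = G by apply: mpoly_fun_inj => x; rewrite -pF.
by apply: top_inj hF _ c0 d0; rewrite E.
Qed.

Lemma eq_lexp p q a : p =1 q -> lexp p a -> lexp q a.
Proof. by move=> e [F [c [pF c0 hF]]]; exists F, c; split=> // x; rewrite -e. Qed.

Lemma lexp_affine p a c b : c != 0 -> a != 0%MM -> lexp p a -> lexp (fun x => p x * c + b) a.
Proof.
move=> c0 a0 [F [d [pF d0 hF]]]; exists (c *: F + b%:MP), (c * d + 0).
split=> [x||]; [|by rewrite addr0 mulf_neq0|].
  by rewrite mevalD mevalZ mevalC pF mulrC.
apply: topD; first exact: topZ.
apply: low_top; apply: top_low (@topC _ b) _; apply: wlt_wt.
have -> : wt 0%MM = 0%N by rewrite /wt !mnm0E.
by rewrite lt0n; apply: contraNneq a0 => /wt_eq0 ->.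
Qed.

Lemma lexp_addmul e p q r a b c : lexp p a -> lexp q b -> lexp r c -> e != 0 ->
  (wt a < wt b + wt c)%N -> lexp (fun x => p x + e * (q x * r x)) (b + c)%MM.
Proof.
move=> [F [x [pF x0 hF]]] [G [y [pG y0 hG]]] [H [z [pH z0 hH]]] e0 w.
exists (F + e *: (G * H)), (0 + e * (y * z)); split=> [v||].
- by rewrite pF pG pH mevalD mevalZ mevalM.
- by rewrite add0r !mulf_neq0.
apply: topD; last by apply: topZ; apply: topM.
by apply: low_top; apply: top_low hF _; apply: wlt_wt; rewrite wtD.
Qed.

Lemma lexp_coord i : lexp (fun x => x 0 i) U_(i)%MM.
Proof. by exists 'X_i, 1; split=> [x||]; [rewrite mevalXU|exact: oner_neq0|exact: topX]. Qed.

Definition lexp3 (phi : pt k -> pt k) a b c : Prop :=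
  [/\ lexp (fun x => phi x 0 i0) a, lexp (fun x => phi x 0 i1) b &
    lexp (fun x => phi x 0 i2) c].

(** The weight condition says that the substituted leading monomial outweighs every other
    substituted monomial, so nothing cancels its leading term. *)
Lemma lexp_comp p mu (phi : pt k -> pt k) a0 a1 a2 : lexp p mu -> lexp3 phi a0 a1 a2 ->
  (forall m, wlt m mu -> (wt a0 * m i0 + wt a1 * m i1 + wt a2 * m i2 <
    wt a0 * mu i0 + wt a1 * mu i1 + wt a2 * mu i2)%N) ->
  lexp (fun x => p (phi x)) (a0 *+ mu i0 + a1 *+ mu i1 + a2 *+ mu i2)%MM.
Proof.
move=> [F [c [pF c0 hF]]] [[F0 [d0 [p0 n0 h0]]] [F1 [d1 [p1 n1 h1]]] [F2 [d2 [p2 n2 h2]]]] dom.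
pose mon (m : 'X_{1..3}) := F0 ^+ m i0 * F1 ^+ m i1 * F2 ^+ m i2.
pose ex (m : 'X_{1..3}) := (a0 *+ m i0 + a1 *+ m i1 + a2 *+ m i2)%MM.
pose G : {mpoly k[3]} := \sum_(m <- msupp F) F@_m *: mon m.
have hG x : p (phi x) = G.@[x 0].
  rewrite pF mevalE raddf_sum; apply: eq_bigr => m _; rewrite /= mevalZ prod3.
  by rewrite /mon !mevalM !rmorphXn /= -p0 -p1 -p2.
have top_mon m : top (mon m) (ex m) (d0 ^+ m i0 * d1 ^+ m i1 * d2 ^+ m i2).
  by do ![apply: topM]; apply: topXn.
have e0 : d0 ^+ mu i0 * d1 ^+ mu i1 * d2 ^+ mu i2 != 0 by rewrite !mulf_neq0 // expf_neq0.
exists G, (c * (d0 ^+ mu i0 * d1 ^+ mu i1 * d2 ^+ mu i2)); split=> //.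
  by rewrite mulf_neq0.
have hmu : mu \in msupp F by rewrite mcoeff_msupp (top_coeff hF).
rewrite /G (bigD1_seq mu) //= (top_coeff hF).
rewrite -[X in top _ _ X]addr0; apply: topD; first exact: topZ.
apply: low_top; rewrite big_seq_cond; apply: (big_ind (low (ex mu))).
- exact: low0.
- exact: lowD.
move=> m /andP [hm ne]; apply: lowZ; apply: top_low (top_mon m) _; apply: wlt_wt.
have lt : wlt m mu.
  have low_tail : low mu (F - c *: 'X_[mu]) := hF.
  apply: low_tail; move: hm; rewrite !mcoeff_msupp mcoeffB mcoeffZ mcoeffX.
  by rewrite [mu == m]eq_sym (negbTE ne) mulr0 subr0.
by rewrite /ex !wtD !wtMn; apply: dom.
Qed.

End LeadingExponent.

(** * Growth of leading exponents under iterates of [f] and its inverse *)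

Section Dynamics.
Variable k : fieldType.
Hypothesis hk : [pchar k] =i pred0.
Implicit Types (p q r : pt k -> k) (phi : pt k -> pt k).

Definition gmap (x : pt k) : pt k := mk3 (x 0 i1 - x 0 i0 * x 0 i2) (x 0 i0) (x 0 i2).
Definition hmap (x : pt k) : pt k := mk3 (x 0 i1) (x 0 i2) (x 0 i0).

Lemma gmapK : cancel gmap (@ginv k).
Proof.
move=> x; apply/rowP; apply: forall3; rewrite /ginv /gmap !mk3E //=.
by rewrite subrK.
Qed.

Lemma ginvK : cancel (@ginv k) gmap.
Proof.
move=> x; apply/rowP; apply: forall3; rewrite /ginv /gmap !mk3E //=.
by rewrite addrK.
Qed.

Lemma hmapK : cancel hmap (@hinv k).
Proof. by move=> x; apply/rowP; apply: forall3; rewrite /hinv /hmap !mk3E. Qed.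

Lemma hinvK : cancel (@hinv k) hmap.
Proof. by move=> x; apply/rowP; apply: forall3; rewrite /hinv /hmap !mk3E. Qed.

(** [stepf n] is the automorphism [f] of the theorem and [stepb n] its inverse, written with the
    explicit [g] and [h]. *)
Definition stepf n (x : pt k) := iter n gmap (hmap x).
Definition stepb n (x : pt k) := hinv (iter n (@ginv k) x).

Lemma iter_cancel (T : Type) (u v : T -> T) n : cancel u v -> cancel (iter n u) (iter n v).
Proof. by move=> uK; elim: n => // n IH x; rewrite (iterSr n v) iterS uK IH. Qed.

Lemma stepfK n : cancel (stepf n) (stepb n).
Proof. by move=> x; rewrite /stepb iter_cancel ?hmapK //; apply: gmapK. Qed.

Lemma stepbK n : cancel (stepb n) (stepf n).
Proof. by move=> x; rewrite /stepf hinvK iter_cancel //; apply: ginvK. Qed.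

(** One application of [gmap] turns the exponents [(a, b, c)] into [(a + c, a, c)], since the
    product outweighs the other term; the inequality needed for this persists. *)
Lemma iter_gmap_lexp phi a b c i : lexp3 phi a b c ->
  (wt b < wt a + wt c)%N -> (0 < wt c)%N ->
  lexp3 (fun x => iter i.+1 gmap (phi x)) (a + c *+ i.+1)%MM (a + c *+ i)%MM c.
Proof.
have step (psi : pt k -> pt k) a' b' c' : lexp3 psi a' b' c' -> (wt b' < wt a' + wt c')%N ->
    lexp3 (fun x => gmap (psi x)) (a' + c')%MM a' c'.
  move=> [h0 h1 h2] w; split.
  - apply: eq_lexp (lexp_addmul h1 h0 h2 (e := -1) _ w); last by rewrite oppr_eq0 oner_neq0.
    by move=> x; rewrite mk3E /= mulN1r.
  - by apply: eq_lexp h0 => x; rewrite mk3E.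
  - by apply: eq_lexp h2 => x; rewrite mk3E.
move=> h w c0; elim: i => [|i IH]; first by rewrite mulm1n mulm0n addm0; exact: step h w.
have := step _ _ _ _ IH; rewrite -addmA -mulmSr; apply.
by rewrite !wtD !wtMn; lia.
Qed.

(** Likewise [ginv] turns [(a, b, c)] into [(b, b + c, c)]. *)
Lemma iter_ginv_lexp phi a b c i : lexp3 phi a b c ->
  (wt a < wt b + wt c)%N -> (0 < wt c)%N ->
  lexp3 (fun x => iter i.+1 (@ginv k) (phi x)) (b + c *+ i)%MM (b + c *+ i.+1)%MM c.
Proof.
have step (psi : pt k -> pt k) a' b' c' : lexp3 psi a' b' c' -> (wt a' < wt b' + wt c')%N ->
    lexp3 (fun x => ginv (psi x)) b' (b' + c')%MM c'.
  move=> [h0 h1 h2] w; split.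
  - by apply: eq_lexp h1 => x; rewrite mk3E.
  - apply: eq_lexp (lexp_addmul h0 h1 h2 (oner_neq0 _) w).
    by move=> x; rewrite mk3E /= mul1r.
  - by apply: eq_lexp h2 => x; rewrite mk3E.
move=> h w c0; elim: i => [|i IH]; first by rewrite mulm1n mulm0n addm0; exact: step h w.
have := step _ _ _ _ IH; rewrite -addmA -mulmSr; apply.
by rewrite !wtD !wtMn; lia.
Qed.

Lemma wtU (i : 'I_3) : wt U_(i)%MM = nth 0%N [:: 3; 2; 2]%N i.
Proof. by rewrite /wt !mnm1E; move: i; apply: forall3. Qed.

(** One step turns [(a, b, c)] into [(b + n a, b + (n - 1) a, a)]. The bound on [wt c] rules out
    cancellation at the next step; the last clause prepares the comparison of weights in
    [pure_x2_stepf]. *)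
Lemma stepf_lexp n j : (3 <= n)%N -> exists a b c, [/\ lexp3 (iter j (stepf n)) a b c,
  (wt c < wt a + wt b)%N, (0 < a i0)%N /\ a i2 = 0%N, (0 < wt b)%N /\ b i2 = 0%N &
  (0 < j)%N -> [/\ 2 * wt a < 3 * wt b, wt c < wt b & 0 < b i0]%N].
Proof.
case: n => [//|n] hn; elim: j => [|j [a [b [c [[h0 h1 h2] w [a0 a2] [b0 b2] _]]]]].
  exists U_(i0)%MM, U_(i1)%MM, U_(i2)%MM; split=> //; first by split; apply: lexp_coord.
  - by rewrite !wtU.
  - by rewrite !mnm1E.
  - by rewrite !mnm1E !wtU.
have wa : (0 < wt a)%N by rewrite /wt; lia.
exists (b + a *+ n.+1)%MM, (b + a *+ n)%MM, a; split.
- have hphi : lexp3 (fun x => hmap (iter j (stepf n.+1) x)) b c a.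
    by split; [move: h1|move: h2|move: h0]; apply: eq_lexp => x; rewrite mk3E.
  by apply: (iter_gmap_lexp n hphi) => //; rewrite addnC.
- by rewrite !wtD !wtMn; lia.
- by rewrite !mnmDE !mulmnE; lia.
- by rewrite !mnmDE !mulmnE wtD wtMn; lia.
(* With [n.+1] applications of [gmap], the first inequality amounts to [(2 - n) wt a < wt b] for the
   previous exponents, and [n] is at least 2. *)
- by move=> _; split; rewrite ?mnmDE ?mulmnE ?wtD ?wtMn; nia.
Qed.

(** One step turns [(a, b, c)] into [(c, b + (n - 1) c, b + n c)], so [x1] is absent from the last
    two exponents at the start and from all three after one step. *)
Lemma stepb_lexp n j : (3 <= n)%N -> exists a b c, [/\ lexp3 (iter j (stepb n)) a b c,
  (wt a < wt b + wt c)%N, (0 < b i1)%N /\ b i0 = 0%N, (0 < c i2)%N /\ c i0 = 0%N &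
  (0 < j)%N -> [/\ 2 * wt a < 3 * wt c, wt b < wt c, 0 < c i1, a i0 = 0 & 0 < a i2]%N].
Proof.
case: n => [//|n] hn; elim: j => [|j [a [b [c [h w [b1 b0] [c2 c0] _]]]]].
  exists U_(i0)%MM, U_(i1)%MM, U_(i2)%MM; split=> //; first by split; apply: lexp_coord.
  - by rewrite !wtU.
  - by rewrite !mnm1E.
  - by rewrite !mnm1E.
have wb : (0 < wt b)%N by rewrite /wt; lia.
have wc : (0 < wt c)%N by rewrite /wt; lia.
exists c, (b + c *+ n)%MM, (b + c *+ n.+1)%MM; split.
- have [h0 h1 h2] := iter_ginv_lexp n h w wc.
  by split; [move: h2|move: h0|move: h1]; apply: eq_lexp => x; rewrite [RHS]mk3E.
- by rewrite !wtD !wtMn; lia.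
- by rewrite !mnmDE !mulmnE; lia.
- by rewrite !mnmDE !mulmnE; lia.
- by move=> _; split; rewrite ?mnmDE ?mulmnE ?wtD ?wtMn; nia.
Qed.

(** A monomial below [x2^d] is a smaller power of [x2], or involves another variable and has weight
    at most [2 d]. The bounds [2 wt a < 3 wt b] and [wt c < wt b] make its image lighter than that
    of [x2^d], whose exponent [d b] involves [x1]. *)
Lemma pure_x2_stepf n j p mu : (3 <= n)%N -> (0 < j)%N -> lexp p mu ->
  mu i0 = 0%N -> (0 < mu i1)%N -> mu i2 = 0%N ->
  exists nu, lexp (fun x => p (iter j (stepf n) x)) nu /\ (0 < nu i0)%N.
Proof.
move=> hn j0 hp m0 m1 m2.
have [a [b [c [h _ [a0 _] [b0 _] /(_ j0) [w1 w2 bi]]]]] := stepf_lexp j hn.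
exists (a *+ mu i0 + b *+ mu i1 + c *+ mu i2)%MM; split; last first.
  by rewrite !mnmDE !mulmnE m0 m2; nia.
apply: (lexp_comp hp h) => m lt.
have : (m i0 = 0 /\ m i2 = 0 /\ m i1 < mu i1 \/
  (0 < m i0 + m i2)%N /\ 3 * m i0 + 2 * m i1 + 2 * m i2 <= 2 * mu i1)%N.
  by move: lt; rewrite /wlt /wt m0 m2; lia.
by rewrite m0 m2; case=> [[-> [-> ?]]|[? ?]]; nia.
Qed.

(** The same comparison for [x3^d], now with [2 wt a < 3 wt c] and [wt b < wt c], where [c] involves
    [x2]. *)
Lemma pure_x3_stepb n j p mu : (3 <= n)%N -> (0 < j)%N -> lexp p mu ->
  mu i0 = 0%N -> mu i1 = 0%N -> (0 < mu i2)%N ->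
  exists nu, lexp (fun x => p (iter j (stepb n) x)) nu /\ (0 < nu i1)%N.
Proof.
move=> hn j0 hp m0 m1 m2.
have [a [b [c [h _ [b1 _] [c2 _] /(_ j0) [w1 w2 ci _ _]]]]] := stepb_lexp j hn.
exists (a *+ mu i0 + b *+ mu i1 + c *+ mu i2)%MM; split; last first.
  by rewrite !mnmDE !mulmnE m0 m1; nia.
apply: (lexp_comp hp h) => m lt.
have : (m i0 = 0 /\ m i1 = 0 /\ m i2 < mu i2 \/
  (0 < m i0 + m i1)%N /\ 3 * m i0 + 2 * m i1 + 2 * m i2 <= 2 * mu i2)%N.
  by move: lt; rewrite /wlt /wt m0 m1; lia.
by rewrite m0 m1; case=> [[-> [-> ?]]|[? ?]]; nia.
Qed.

End Dynamics.

(** * Walks in the complex as chains of components *)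

Section Walks.
Variable k : fieldType.
Hypothesis hk : [pchar k] =i pred0.
Implicit Types (p q : pt k -> k) (phi t : pt k -> pt k).

Lemma eq_tame t t' : t =1 t' -> tame t -> tame t'.
Proof. by move=> e [s [ok ht]]; exists s; split=> // x; rewrite -e. Qed.

Lemma tame_comp t t' : tame t -> tame t' -> tame (fun x => t (t' x)).
Proof.
move=> [s [ok ht]] [s' [ok' ht']]; exists (s ++ s'); split.
  by elim: s ok {ht} => //= g s IH [okg /IH].
by move=> x; rewrite foldr_cat ht ht'.
Qed.

Lemma tame_id : tame (fun x : pt k => x).
Proof. by exists [::]. Qed.

Lemma tame_iter t n : tame t -> tame (iter n t).
Proof. by move=> ht; elim: n => [|n IH]; [exact: tame_id|exact: (tame_comp ht IH)]. Qed.

Lemma tame_perm (s : 'S_3) : tame (fun x : pt k => \row_i x 0 (s i)).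
Proof.
exists [:: GAff (perm_mx s^-1) 0]; split=> [|x]; first by rewrite /= unitmx_perm.
by rewrite /= addr0 -col_permE; apply/rowP => i; rewrite !mxE.
Qed.

Lemma tame_elem (c : k) :
  tame (fun x : pt k => mk3 (x 0 i0 + c * (x 0 i1 * x 0 i2)) (x 0 i1) (x 0 i2)).
Proof.
exists [:: GEl ((c *: 'X)%:P * 'X)]; split=> // x; rewrite /= hornerM hornerC hornerX.
by rewrite hornerM hornerZ hornerX hornerC mulrA.
Qed.

Lemma tperm_row (x : pt k) (i j l : 'I_3) :
  (\row_i' x 0 (tperm i j i')) 0 l = x 0 (if l == i then j else if l == j then i else l).
Proof.
rewrite mxE; case: tpermP => [->|->|/eqP/negbTE -> /eqP/negbTE ->] //; rewrite eqxx //.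
by case: eqP => [->|].
Qed.

Lemma tame_ginv : tame (@ginv k).
Proof.
apply: eq_tame (tame_comp (tame_perm (tperm i0 i1)) (tame_elem 1)) => x.
by apply/rowP; apply: forall3; rewrite tperm_row !mk3E /= ?mul1r.
Qed.

Lemma tame_gmap : tame (@gmap k).
Proof.
apply: eq_tame (tame_comp (tame_elem (-1)) (tame_perm (tperm i0 i1))) => x.
by apply/rowP; apply: forall3; rewrite !mk3E /= !tperm_row /= ?mulN1r.
Qed.

Lemma tame_hmap : tame (@hmap k).
Proof.
apply: eq_tame (tame_comp (tame_perm (tperm i1 i2)) (tame_perm (tperm i0 i1))) => x.
by apply/rowP; apply: forall3; rewrite !mk3E !tperm_row.
Qed.

Lemma tame_hinv : tame (@hinv k).
Proof.
apply: eq_tame (tame_comp (tame_perm (tperm i0 i1)) (tame_perm (tperm i1 i2))) => x.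
by apply/rowP; apply: forall3; rewrite !mk3E !tperm_row.
Qed.

Lemma tame_stepf n : tame (@stepf k n).
Proof. exact: tame_comp (tame_iter n tame_gmap) tame_hmap. Qed.

Lemma tame_stepb n : tame (@stepb k n).
Proof. exact: tame_comp tame_hinv (tame_iter n tame_ginv). Qed.

(** The first coordinate of any vertex in the triangle of [t], of whatever type and representative,
    has this form, so one notion covers all edges. *)
Definition component t p : Prop :=
  exists (u : 'cV[k]_3) (b : k), u != 0 /\ forall x, p x = (t x *m u) 0 0 + b.

Definition linked p q : Prop := exists t, [/\ tame t, component t p & component t q].

Lemma component_lexp t p P : tame t -> represents t P -> component t p ->
  exists u b a c, [/\ forall x, p x = (aff_comb u b P).@[x 0], c != 0,
    top (aff_comb u b P) a c & a != 0%MM].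
Proof.
move=> tt hP [u [b [u0 hp]]]; exists u, b.
have pE x : p x = (aff_comb u b P).@[x 0].
  by rewrite hp meval_aff_comb mxE; congr (_ + _); apply: eq_bigr => j _; rewrite hP.
have nconst c : aff_comb u b P != c%:MP.
  apply/eqP => E; have [j uj] : exists j, u j 0 != 0.
    apply/existsP; apply: contraNT u0 => /existsPn h; apply/eqP/colP => j.
    by rewrite mxE; apply/eqP; rewrite -[_ == _]negbK.
  (* Surjectivity of [t] gives a point where [p] takes the value [c + 1]. *)
  have [x hx] := tame_surj tt ((c - b + 1) / u j 0 *: delta_mx 0 j).
  have : p x = c by rewrite pE E mevalC.
  rewrite hp hx -scalemxAl -rowE !mxE divfK // => E1.
  have : (1 : k) = c - b + 1 + b - c by ring.
  by rewrite E1 subrr => /eqP; rewrite oner_eq0.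
have F0 : aff_comb u b P != 0 by rewrite -mpolyC0.
have [a [c [c0 hF]]] := top_exists F0; exists a, c; split=> //.
(* If [a] were 0, the nonzero difference with the constant would have a monomial below 0, the
   minimum of the order. *)
apply/eqP => a0; move: (nconst c); rewrite -subr_eq0 -alg_mpolyC -mpolyX0 -a0.
rewrite -msupp_eq0; case E : msupp => [//|m s] _.
have low_tail : low a (aff_comb u b P - c *: 'X_[a]) := hF.
have := low_tail m; rewrite E mem_head a0 => /(_ isT).
by rewrite /wlt /wt !mnm0E; lia.
Qed.

Lemma linked_lexp p q : linked p q ->
  exists a b, [/\ lexp p a, lexp q b, a != 0%MM, b != 0%MM & coplanar a b].
Proof.
case=> t [tt cp cq]; have [P [hP tP]] := tame_represents tt.
have [u [b [a [c [pE c0 hF a0]]]]] := component_lexp tt hP cp.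
have [u' [b' [a' [c' [qE c'0 hG a'0]]]]] := component_lexp tt hP cq.
exists a, a'; split=> //; [by exists (aff_comb u b P), c|by exists (aff_comb u' b' P), c'|].
exact: aff_comb_coplanar hk tP hF hG c0 c'0.
Qed.

Lemma linked_sym p q : linked p q -> linked q p.
Proof. by case=> t [tt cp cq]; exists t. Qed.

Lemma linked_comp p q phi : tame phi -> linked p q ->
  linked (fun x => p (phi x)) (fun x => q (phi x)).
Proof.
move=> hphi [t [tt [u [b [u0 hp]]] [u' [b' [u'0 hq]]]]].
exists (fun x => t (phi x)); split; first exact: tame_comp.
- by exists u, b.
- by exists u', b'.
Qed.

Definition rep (v : vtx k) : pt k -> k :=
  match v with
  | V1 F => fun x => F x 0 0 | V2 F => fun x => F x 0 0 | V3 F => fun x => F x 0 0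
  end.

Lemma aff_eq_component r (F : pt k -> 'rV[k]_r.+1) t : (r < 3)%N ->
  aff_eq F (trunc r.+1 t) -> component t (fun x => F x 0 0).
Proof.
move=> r3 [A [uA [b hF]]].
(* [E] extracts the first [r + 1] coordinates; as [r < 3] these are distinct, so [E] keeps the first
   column of the inverse of [A] nonzero. *)
pose E : 'M[k]_(3, r.+1) := \matrix_(j, i) (j == inord i)%:R.
have tE x : trunc r.+1 t x = t x *m E.
  apply/rowP => i; rewrite !mxE (bigD1 (inord i)) //= mxE eqxx mulr1 big1 ?addr0 //.
  by move=> j /negbTE ji; rewrite mxE ji mulr0.
exists (E *m col 0 (invmx A)), (- (b *m invmx A) 0 0); split; last first.
  move=> x; have -> : F x = (trunc r.+1 t x - b) *m invmx A by rewrite hF addrK mulmxK.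
  by rewrite tE mulmxBl [LHS]mxE [(- _ : 'M_(_, _)) _ _]mxE colE !mulmxA -colE [col _ _ _ _]mxE.
apply/eqP => E0; have c0 : col 0 (invmx A) = 0.
  apply/colP => i; have := congr1 (fun M : 'cV_3 => M (inord i) 0) E0.
  rewrite /= mxE (bigD1 i) //= [E _ _]mxE eqxx mul1r big1 ?addr0.
    by rewrite [RHS]mxE => ->; rewrite mxE.
  move=> j ji; rewrite [E _ _]mxE (_ : _ == _ = false) ?mul0r //; apply: contraNF ji.
  move/eqP/(congr1 (@nat_of_ord 3)); rewrite !inordK ?(leq_trans (ltn_ord _)) // => e.
  by apply/eqP/val_inj.
have : A *m col 0 (invmx A) = delta_mx 0 0 :> 'cV_r.+1 by rewrite colE mulmxA mulmxV // mul1mx.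
rewrite c0 mulmx0 => /matrixP /(_ 0 0); rewrite !mxE !eqxx => /eqP.
by rewrite eq_sym oner_eq0.
Qed.

Lemma component1 u t : same u (V1 (trunc 1 t)) -> component t (rep u).
Proof. by case: u => // F; apply: aff_eq_component. Qed.

Lemma component2 u t : same u (V2 (trunc 2 t)) -> component t (rep u).
Proof. by case: u => // F; apply: aff_eq_component. Qed.

Lemma component3 u t : same u (V3 (trunc 3 t)) -> component t (rep u).
Proof. by case: u => // F; apply: aff_eq_component. Qed.

Lemma adjacent_linked u v : adjacent u v -> linked (rep u) (rep v).
Proof.
case=> t [tt H]; exists t; split=> //;
case: H => [[[h h']|[h h']]|[[[h h']|[h h']]|[[h h']|[h h']]]];
by [apply: component1 h|apply: component1 h'|apply: component2 h|apply: component2 h'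
   |apply: component3 h|apply: component3 h'].
Qed.

(** The chain starts at [rep u] itself but reaches [G] only up to an invertible affine change, since
    a walk ends up to [same]. *)
Lemma walk_chain m u (G : pt k -> 'rV[k]_1) : walk m u (V1 G) ->
  exists s : nat -> pt k -> k, [/\ s 0%N = rep u,
    forall i, (i < m)%N -> linked (s i) (s i.+1) &
    exists c b, c != 0 /\ forall x, s m x = G x 0 0 * c + b].
Proof.
elim: m u => [|m IH] u /=.
  case=> _; case: u => // F [A [uA [b hF]]]; exists (fun _ x => F x 0 0); split=> //.
  have a0 : A 0 0 != 0 by move: uA; rewrite unitmxE det_mx11 unitfE.
  exists (A 0 0)^-1, (- (b 0 0 / A 0 0)); split=> [|x]; first by rewrite invr_eq0.
  by rewrite hF !mxE big_ord1 mulrDl mulfK // addrK.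
case=> _ [w [/adjacent_linked uw /IH [s [s0 hs sm]]]].
exists (fun i => if i is i'.+1 then s i' else rep u); split=> //.
by case=> [|i] hi; [rewrite s0|apply: hs].
Qed.

(** Directions on one of the two sides of the triangle through the corner [x1], the two other
    corners excluded. *)
Definition left_exp (a : 'X_{1..3}) : bool := (0 < a i0)%N && ((a i1 == 0%N) || (a i2 == 0%N)).

(** Proportional exponents have the same direction. Otherwise the common vanishing coordinate is
    that of [x2] or [x3], so [b] stays on a side through [x1] and can fail [left_exp] only at the
    opposite corner of that side. *)
Lemma left_step (a b : 'X_{1..3}) : coplanar a b -> left_exp a -> b != 0%MM ->
  left_exp b \/ b i0 = 0%N /\ ((0 < b i1)%N /\ b i2 = 0%N \/ b i1 = 0%N /\ (0 < b i2)%N).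
Proof.
rewrite /left_exp => hab /andP [a0 ha] b0.
have {}b0 : (0 < b i0 + b i1 + b i2)%N.
  rewrite lt0n; apply: contraNneq b0 => e; apply/eqP; apply: mnm3P; rewrite mnm0E; lia.
case: hab => [[e12 e02 e01]|[i]]; last by move: i; apply: forall3; lia.
case: (posnP (b i0)) => [z|p]; last by left; nia.
by exfalso; nia.
Qed.

(** Pigeonhole: each [j] is sent to a place of the chain where the leading monomial is a pure power,
    together with its variable, [x2] or [x3]; there are [2 m] such pairs. *)
Lemma chain_bound n m M (s : nat -> pt k -> k) : (3 <= n)%N ->
  (forall i, (i < m)%N -> linked (s i) (s i.+1)) ->
  (forall j, (j < M)%N -> exists a, lexp (fun x => s 0%N (iter j (stepf n) x)) a /\ left_exp a) ->
  (forall j, (j < M)%N -> exists a, lexp (fun x => s m (iter j (stepf n) x)) a /\ a i0 = 0%N) ->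
  (M <= 2 * m)%N.
Proof.
move=> hn hs h0 hm.
(* The Boolean is true for [x2]. The index is shifted because the start of the chain has a left
   exponent and is never pure. *)
pose pure i j (e : bool) := exists a, [/\ lexp (fun x => s i.+1 (iter j (stepf n) x)) a,
  a i0 = 0%N & if e then (0 < a i1)%N /\ a i2 = 0%N else a i1 = 0%N /\ (0 < a i2)%N].
have hit (j : 'I_M) : exists z : 'I_m * bool, pure z.1 j z.2.
  (* As long as no pure power has been met the exponent stays in [left_exp], which the end of the
     chain contradicts. *)
  have cross i : (i <= m)%N -> (exists z : 'I_m * bool, pure z.1 j z.2) \/
      exists a, lexp (fun x => s i (iter j (stepf n) x)) a /\ left_exp a.
    elim: i => [_|i IH im]; first by right; apply: h0.
    case: (IH (ltnW im)) => [|[a [ha la]]]; first by left.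
    have [a' [b [ha' hb _ b0 cop]]] :=
      linked_lexp (linked_comp (tame_iter j (tame_stepf n)) (hs _ im)).
    rewrite -(lexp_inj hk ha ha') in cop.
    case: (left_step cop la b0) => [lb|[z [e|e]]]; first by right; exists b.
      by left; exists (Ordinal im, true), b.
    by left; exists (Ordinal im, false), b.
  case: (cross m (leqnn m)) => // -[a [ha la]].
  have [b [hb b0]] := hm _ (ltn_ord j).
  by move: la; rewrite /left_exp (lexp_inj hk ha hb) b0.
have [z hz] := fin_all_exists hit.
(* Two values of [j] differ by a power of [f]: applied forwards it makes a pure power of [x2]
   involve [x1], and its inverse makes a pure power of [x3] involve [x2]. *)
have once i e j j' : (j < j')%N -> pure i j e -> pure i j' e -> False.
  move=> jj; have d0 : (0 < j' - j)%N by rewrite subn_gt0.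
  case: e => -[a [ha a0 [a1 a2]]] [b [hb b0 [b1 b2]]].
    have [nu [hnu]] := pure_x2_stepf hn d0 ha a0 a1 a2.
    rewrite (lexp_inj hk hnu (b := b)) ?b0 //.
    by apply: eq_lexp hb => x; rewrite -iterD subnKC // ltnW.
  have [nu [hnu]] := pure_x3_stepb hn d0 hb b0 b1 b2.
  rewrite (lexp_inj hk hnu (b := a)) ?a1 //.
  apply: eq_lexp ha => x; rewrite -{1}(subnKC (ltnW jj)) iterD.
  by rewrite (iter_cancel (j' - j) (@stepbK k n)).
have z_inj : injective z.
  move=> j j' e; have := hz j; have := hz j'; rewrite -e => pj' pj.
  apply: val_inj; case: (ltngtP j j') => // l.
  - by case: (once _ _ _ _ l pj pj').
  - by case: (once _ _ _ _ l pj' pj).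
by have := leq_card z z_inj; rewrite card_prod card_bool !card_ord mulnC.
Qed.

End Walks.

(** * Displacement of the base vertex *)

Section Displacement.
Variable k : fieldType.
Hypothesis hk : [pchar k] =i pred0.

Definition base : vtx k := V1 (trunc 1 id).

Lemma repE (G : pt k -> pt k) x : trunc 1 G x 0 0 = G x 0 i0.
Proof. by rewrite mxE; congr (G x 0 _); apply: val_inj; rewrite /= inordK. Qed.

Lemma left_coord1 n j : (3 <= n)%N ->
  exists a, [/\ lexp (fun x : pt k => iter j (stepf n) x 0 i0) a, left_exp a & a != 0%MM].
Proof.
move=> hn; have [a [b [c [[h _ _] _ [a0 a2] _ _]]]] := stepf_lexp k j hn.
exists a; split=> //; first by rewrite /left_exp a0 a2 eqxx orbT.
by apply: contraTneq a0 => ->; rewrite mnm0E.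
Qed.

Lemma right_coord1 n j : (3 <= n)%N -> (0 < j)%N ->
  exists a, [/\ lexp (fun x : pt k => iter j (stepb n) x 0 i0) a, a i0 = 0%N & a != 0%MM].
Proof.
move=> hn j0; have [a [b [c [[h _ _] _ _ _ /(_ j0) [_ _ _ a0 a2]]]]] := stepb_lexp k j hn.
by exists a; split=> //; apply: contraTneq a2 => ->; rewrite mnm0E.
Qed.

Lemma iter_stepb_stepf n M j (x : pt k) : (j <= M)%N ->
  iter M (stepb n) (iter j (stepf n) x) = iter (M - j) (stepb n) x.
Proof.
by move=> jM; rewrite -{1}(subnK jM) iterD (iter_cancel j (@stepfK k n)).
Qed.

(** After composition with [f^j], [j < M], the chain goes from [x1 o f^j], with a left exponent, to
    [x1 o f^-(M-j)], whose leading monomial is free of [x1]. *)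
Lemma walk_stepb n M m : (3 <= n)%N -> walk m base (act (iter M (stepb n)) base) -> (M <= 2 * m)%N.
Proof.
move=> hn /walk_chain [s [s0 hs [c [b [c0 sm]]]]].
apply: (chain_bound hk hn hs) => j jM.
  have [a [ha la _]] := left_coord1 j hn; exists a; split=> //.
  by apply: eq_lexp ha => x; rewrite s0 /= repE.
have [|a [ha a0 an]] := @right_coord1 n (M - j) hn; first by rewrite subn_gt0.
exists a; split=> //; apply: eq_lexp (lexp_affine b c0 an ha) => x.
by rewrite sm repE iter_stepb_stepf // ltnW.
Qed.

(** Composing the chain with [f^-M] and reversing it gives the endpoints of the other direction.
    [phi] is compared pointwise because the theorem gives [g] and [h] only through their
    inverses. *)
Lemma walk_stepf n M m phi : (3 <= n)%N -> phi =1 iter M (@stepf k n) ->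
  walk m base (act phi base) -> (M <= 2 * m)%N.
Proof.
move=> hn hphi /walk_chain [s [s0 hs [c [b [c0 sm]]]]].
apply: (chain_bound hk (s := fun i x => s (m - i)%N (iter M (stepb n) x)) hn) => [i im|j jM|j jM].
- apply: (linked_comp (tame_iter M (tame_stepb k n))); apply: linked_sym.
  by have := hs (m - i.+1)%N; rewrite -subSn // subSS; apply; lia.
- have [a [ha la an]] := left_coord1 j hn; exists a; split=> //.
  apply: eq_lexp (lexp_affine b c0 an ha) => x.
  by rewrite subn0 sm repE hphi (iter_cancel M (@stepbK k n)).
- have [|a [ha a0 an]] := @right_coord1 n (M - j) hn; first by rewrite subn_gt0.
  exists a; split=> //; apply: eq_lexp ha => x.
  by rewrite subnn s0 /= repE iter_stepb_stepf // ltnW.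
Qed.

End Displacement.

Theorem theoremC (k : fieldType) (hk : [pchar k] =i pred0) (n : nat) (hn : (3 <= n)%N)
  (g h : pt k -> pt k)
  (hg1 : forall x, g (ginv x) = x) (hg2 : forall x, ginv (g x) = x)
  (hh1 : forall x, h (hinv x) = x) (hh2 : forall x, hinv (h x) = x) :
  let f := fun x => iter n g (h x) in
  let finv := fun x => hinv (iter n (@ginv k) x) in
  loxodromic f finv /\ infinite_diameter k.
Proof.
move=> f finv.
have gE : g =1 @gmap k by move=> x; rewrite -[RHS]hg1 gmapK.
have hE : h =1 @hmap k by move=> x; rewrite -[RHS]hh1 hmapK.
have fE : f =1 stepf n by move=> x; rewrite /f hE; apply: eq_iter.
have base_vertex : is_vertex (base k).
  by exists id; split=> //; apply: tame_id.
split.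
  (* The rate 1/2 is the bound [M <= 2 m] on walks of length [m]. *)
  exists (base k); split=> //; exists 2^-1; split; first by rewrite invr_gt0 ltr0n.
  case=> M m; rewrite ler_pdivrMl ?ltr0n // -natrM => hw.
    by rewrite ler_nat; apply: walk_stepb hw.
  by rewrite NegzE normrN ler_nat; apply: (walk_stepf hk hn _ hw) => x; apply: eq_iter.
(* A power of [f] above [2 N] moves the base vertex by more than [N]. *)
move=> N; exists (base k), (act (iter (2 * N).+1 finv) (base k)); split=> //; split.
  exists (iter (2 * N).+1 finv); split; first exact: tame_iter (tame_stepb k n).
  by move=> x; apply/rowP => i; rewrite !mxE.
by move=> m mN /(walk_stepb hk hn); lia.
Qed.
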